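(* Let $n\ge 0$. A function $g\colon \operatorname{AdS}_n\to\mathbb{Z}$ is the rank function $g_D$ of some delta-matroid $D$ on $[n,\overline{n}]$ if and only if all of the following hold: (1) $g(\emptyset)=0$; (2) $|g(S)|\le 1$ for every $S\in\operatorname{AdS}_n$ with $|S|=1$; (3) $g(S)+g(T)\ge g(S\cap T)+g(S\sqcup T)$ for all $S,T\in\operatorname{AdS}_n$; (4) $g(S)\equiv |S| \pmod 2$ for all $S\in\operatorname{AdS}_n$. Furthermore, a delta-matroid $D$ on $[n,\overline{n}]$ is even if and only if $$g_D(S)=\frac{g_D(S\cup\{i\})+g_D(S\cup\{\overline{i}\})}{2}$$ for every $S\in\operatorname{AdS}_n$ with $|S|=n-1$ and every $i\in[n]$ with $\{i,\overline{i}\}\cap S=\emptyset$.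
   Context: Let $[n,\overline{n}]=\{1,\dots,n,\overline{1},\dots,\overline{n}\}$ with the involution $a\mapsto\overline{a}$ (so $\overline{\overline{a}}=a$); for a set $S$ write $\overline{S}=\{\overline{a}:a\in S\}$. A subset $S\subseteq[n,\overline{n}]$ is admissible if it contains at most one of $i,\overline{i}$ for each $i\in[n]$; $\operatorname{AdS}_n$ is the set of admissible subsets. For $S,T\in\operatorname{AdS}_n$, $S\sqcup T=\{a\in S\cup T:\overline{a}\notin S\cup T\}$. In $\mathbb{R}^n$ with standard basis $e_1,\dots,e_n$, set $e_{\overline{i}}=-e_i$ and $e_S=\sum_{a\in S}e_a$. A delta-matroid $D$ on $[n,\overline{n}]$ is a nonempty collection $\mathcal{F}\subseteq\operatorname{AdS}_n$ of admissible sets of size $n$ (the feasible sets) such that the polytope $P(D)=\operatorname{Conv}\{e_B:B\in\mathcal{F}\}$ has every edge parallel to $e_i$ or to $e_i\pm e_j$ for some $i,j$. $D$ is even if every edge of $P(D)$ is parallel to some $e_i\pm e_j$. The rank function of $D$ is $g_D\colon\operatorname{AdS}_n\to\mathbb{Z}$, $g_D(S)=\max_{B\in\mathcal{F}}(|S\cap B|-|\overline{S}\cap B|)$. *)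

(* Defs.v *)
From HB Require Import structures.
From mathcomp Require Import all_boot all_order all_algebra.
Set Implicit Arguments. Unset Strict Implicit. Unset Printing Implicit Defensive.
Import Order.TTheory GRing.Theory Num.Theory.
Local Open Scope ring_scope.

(* Ground set [n, nbar]: (i, false) encodes i, (i, true) encodes \bar i. *)
Definition elt (n : nat) := ('I_n * bool)%type.

Definition bar {n : nat} (a : elt n) : elt n := (a.1, ~~ a.2).

Definition barset {n : nat} (S : {set elt n}) : {set elt n} := [set bar a | a in S].

Definition admissible {n : nat} (S : {set elt n}) : bool :=
  [forall i : 'I_n, ~~ (((i, false) \in S) && ((i, true) \in S))].

Definition sqcup {n : nat} (S T : {set elt n}) : {set elt n} :=
  [set a in S :|: T | bar a \notin S :|: T].

(* e_S in R^n, with e_{\bar i} = - e_i *)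
Definition eS (R : realFieldType) {n : nat} (S : {set elt n}) : 'rV[R]_n :=
  \row_(i < n) (((i, false) \in S)%:R - ((i, true) \in S)%:R).

Definition ev (R : realFieldType) {n : nat} (i : 'I_n) : 'rV[R]_n :=
  \row_(k < n) ((k == i)%:R).

Definition dotv (R : realFieldType) {n : nat} (c x : 'rV[R]_n) : R :=
  \sum_(k < n) c 0 k * x 0 k.

Definition in_conv (R : realFieldType) {n : nat} (F : {set {set elt n}})
  (x : 'rV[R]_n) : Prop :=
  exists lam : {set elt n} -> R,
    [/\ forall B, B \in F -> 0 <= lam B,
        \sum_(B in F) lam B = 1 &
        x = \sum_(B in F) lam B *: eS R B].

Definition in_face (R : realFieldType) {n : nat} (F : {set {set elt n}})
  (c x : 'rV[R]_n) : Prop :=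
  in_conv F x /\ forall y, in_conv F y -> dotv c y <= dotv c x.

Definition in_segment (R : realFieldType) {n : nat} (u v x : 'rV[R]_n) : Prop :=
  exists t : R, [/\ 0 <= t, t <= 1 & x = (1 - t) *: u + t *: v].

Definition is_edge (R : realFieldType) {n : nat} (F : {set {set elt n}})
  (u v : 'rV[R]_n) : Prop :=
  u != v /\ exists c : 'rV[R]_n, forall x, in_face F c x <-> in_segment u v x.

Definition parallel (R : realFieldType) {n : nat} (w d : 'rV[R]_n) : Prop :=
  exists lam : R, w = lam *: d.

Definition even_dir (R : realFieldType) {n : nat} (w : 'rV[R]_n) : Prop :=
  exists i j : 'I_n, i != j /\
    (parallel w (ev R i + ev R j) \/ parallel w (ev R i - ev R j)).

Definition dm_dir (R : realFieldType) {n : nat} (w : 'rV[R]_n) : Prop :=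
  (exists i : 'I_n, parallel w (ev R i)) \/ even_dir w.

Definition is_delta_matroid (R : realFieldType) {n : nat}
  (F : {set {set elt n}}) : Prop :=
  [/\ F != set0,
      forall B, B \in F -> admissible B /\ #|B| = n &
      forall u v : 'rV[R]_n, is_edge F u v -> dm_dir (u - v)].

Definition is_even_dm (R : realFieldType) {n : nat}
  (F : {set {set elt n}}) : Prop :=
  forall u v : 'rV[R]_n, is_edge F u v -> even_dir (u - v).

Definition rk_val {n : nat} (S B : {set elt n}) : int :=
  (#|S :&: B|)%:Z - (#|barset S :&: B|)%:Z.

Definition is_rank_fun {n : nat} (F : {set {set elt n}})
  (g : {set elt n} -> int) : Prop :=
  forall S, admissible S ->
    (exists2 B, B \in F & g S = rk_val S B) /\
    (forall B, B \in F -> rk_val S B <= g S).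

(* Main.v *)
Require Import Defs.
From HB Require Import structures.
From mathcomp Require Import all_boot all_order all_algebra.
From mathcomp Require Import zify ring lra.
Import Order.TTheory GRing.Theory Num.Theory.
Local Open Scope ring_scope.
Set Implicit Arguments.
Unset Strict Implicit.

(** Identify S with the vector e_S in {-1,0,1}^n, so that the rank function is
    the support function of P(D) at e_S.

    Edges are detected by closeness: among the maximizers of a functional c, a
    pair A, B at minimal Hamming distance with phi A <> phi B spans an edge,
    since e_A + e_B cuts out the face of the cube spanned by A and B, where any
    other feasible point would be closer to A and to B and would give a closer
    pair separated by phi.

    If all edges are roots, a chain S <= T has a common maximizer.  Otherwise
    some functional e_S + t e_T with t > 0 has two maximizers with different
    e_T-values, so by the above it has an edge on which e_S and e_T have
    strictly opposite signs; this never happens for a root.  Common maximizers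
    for S :&: T <= sqcup S T give bisubmodularity.

    Conversely, let F be the set of vertices B of the cube with e_S.B <= g S for
    all S.  The greedy algorithm, run inside a full admissible set U, shows that
    for every S <= U some B in F is tight at both S and U.  The choice
    S = (A :&: B) + b_i, U = A with its i-th sign flipped, gives the exchange
    axiom, and exchanging at the index i maximizing |c_i| yields a third
    maximizer of any c whose maximizers A, B differ in more than two places.

    If D is even, all feasible sets have the same parity of barred elements, so
    the values of g at the two extensions of S differ modulo 4, hence are
    g S + 1 and g S - 1.  If D is not even, an edge A, B parallel to e_i violates
    the equation at S = A :&: B. *)

(** * Sign vectors, full admissible sets and rank values *)

Definition sg {n} (S : {set elt n}) (k : 'I_n) : int :=
  ((k, false) \in S)%:Z - ((k, true) \in S)%:Z.

(** The exclusive-or form of being admissible of size [n] (see [fullP]), suited to case analysis one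
    coordinate at a time. *)
Definition full {n} (B : {set elt n}) : bool :=
  [forall k : 'I_n, ((k, false) \in B) (+) ((k, true) \in B)].

Definition diff {n} (A B : {set elt n}) : {set 'I_n} :=
  [set k | sg A k != sg B k].

Lemma barK n : involutive (@bar n).
Proof. by case=> i b; rewrite /bar /= negbK. Qed.

Lemma in_barset n (S : {set elt n}) a : (a \in barset S) = (bar a \in S).
Proof.
apply/imsetP/idP => [[b bS ->]|aS]; first by rewrite barK.
by exists (bar a); rewrite ?barK.
Qed.

Lemma card_elt n (A : {set elt n}) :
  #|A| = (\sum_(k < n) (((k, false) \in A) + ((k, true) \in A)))%N.
Proof.
rewrite -sum1_card big_mkcond /=.
transitivity (\sum_(k < n) \sum_(b : bool) (if (k, b) \in A then 1 else 0))%N.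
  by rewrite pair_big /=; apply: eq_bigr => -[].
apply: eq_bigr => k _; rewrite big_bool /= addnC.
by do 2 case: (_ \in A).
Qed.

Lemma rk_valE n (S B : {set elt n}) :
  rk_val S B = \sum_k sg S k * sg B k.
Proof.
rewrite /rk_val !card_elt -!natz !natr_sum -sumrB; apply: eq_bigr => k _.
rewrite !natrD !natz !inE !in_barset /bar /sg /=.
by do 4 case: (_ \in _).
Qed.

Lemma rk_val_sum n (S B : {set elt n}) :
  rk_val S B = \sum_(a in S) ((a \in B)%:Z - (bar a \in B)%:Z).
Proof.
rewrite rk_valE [RHS]big_mkcond /=.
transitivity (\sum_(k < n) \sum_(b : bool) (if (k, b) \in S then
   ((k, b) \in B)%:Z - (bar (k, b) \in B)%:Z else 0)).
  apply: eq_bigr => k _; rewrite big_bool /bar /sg /=.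
  by do 4 case: (_ \in _).
by rewrite pair_big /=; apply: eq_bigr => -[].
Qed.

Lemma admP n (S : {set elt n}) a : admissible S -> a \in S -> bar a \notin S.
Proof.
by case: a => i [] /forallP /(_ i); rewrite /bar /= negb_and;
  do 2 case: (_ \in S).
Qed.

Lemma sub_adm n (S T : {set elt n}) :
  S \subset T -> admissible T -> admissible S.
Proof.
move=> /subsetP sST /forallP aT; apply/forallP => i.
by apply: contra (aT i) => /andP[/sST -> /sST ->].
Qed.

Lemma fullP n (B : {set elt n}) :
  reflect (admissible B /\ #|B| = n) (full B).
Proof.
apply: (iffP idP) => [/forallP fB|[/forallP aB cB]].
  split; first by apply/forallP => i; move: (fB i); do 2 case: (_ \in B).
  rewrite card_elt -[RHS]card_ord -sum1_card; apply: eq_big => // k _.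
  by move: (fB k); do 2 case: (_ \in B).
(* Each pair contributes at most 1, so a total of [n] forces equality in every pair. *)
have le1 k : true ->
    ((((k, false) \in B) + ((k, true) \in B))%N <= 1 ?= iff
      (((k, false) \in B) (+) ((k, true) \in B)))%N.
  by move=> _; move: (aB k); do 2 case: (_ \in B).
have [_] := leqif_sum le1.
by rewrite -card_elt cB sum1_card card_ord eqxx => /esym /forallP fB;
  apply/forallP.
Qed.

Lemma full_bar n (B : {set elt n}) a : full B -> (bar a \in B) = (a \notin B).
Proof.
by case: a => i [] /forallP /(_ i); rewrite /bar /=; do 2 case: (_ \in B).
Qed.

Lemma sg_full n (B : {set elt n}) k :
  full B -> sg B k = if (k, false) \in B then 1 else -1.
Proof. by move/forallP/(_ k); rewrite /sg; do 2 case: (_ \in B). Qed.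

Lemma full_inj n (A B : {set elt n}) :
  full A -> full B -> (forall k, sg A k = sg B k) -> A = B.
Proof.
move=> fA fB eAB; apply/setP => -[k b]; move: (eAB k).
move/forallP: fA => /(_ k); move/forallP: fB => /(_ k).
by rewrite /sg; case: b; do 4 case: (_ \in _).
Qed.

Lemma diffC n (A B : {set elt n}) : diff A B = diff B A.
Proof. by apply/setP => k; rewrite !inE eq_sym. Qed.

(** A common element counts once in each of the two sets, an element of only one of S, T survives in
    [sqcup] alone, and opposite elements cancel. By linearity every vertex satisfies bisubmodularity
    with equality. *)
Lemma sg_setI_sqcup n (S T : {set elt n}) k : admissible S -> admissible T ->
  sg (S :&: T) k + sg (sqcup S T) k = sg S k + sg T k.
Proof.
move=> /forallP/(_ k) + /forallP/(_ k); rewrite /sg /sqcup !inE /bar /=.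
by do 4 case: (_ \in _).
Qed.

Lemma rk_setI_sqcup n (S T B : {set elt n}) : admissible S -> admissible T ->
  rk_val (S :&: T) B + rk_val (sqcup S T) B = rk_val S B + rk_val T B.
Proof.
move=> aS aT; rewrite !rk_valE -!big_split; apply: eq_bigr => k _ /=.
by rewrite -!mulrDl sg_setI_sqcup.
Qed.

Lemma adm_sqcup n (S T : {set elt n}) : admissible (sqcup S T).
Proof.
apply/forallP => i; rewrite /sqcup !inE /bar /=.
by do 4 case: (_ \in _).
Qed.

Lemma setI_sub_sqcup n (S T : {set elt n}) :
  admissible S -> admissible T -> S :&: T \subset sqcup S T.
Proof.
move=> aS aT; apply/subsetP => a; rewrite !inE => /andP[aS' aT'].
by rewrite aS' /= (negbTE (admP aS aS')) (negbTE (admP aT aT')).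
Qed.

Lemma rk_full n (A B : {set elt n}) : full A -> full B ->
  rk_val A B = n%:Z - 2 * (#|diff A B|)%:Z.
Proof.
move=> fA fB.
have -> : n%:Z = \sum_(k < n) 1 by rewrite sumr_const card_ord natz.
have -> : #|diff A B| = (\sum_k (sg A k != sg B k))%N.
  by rewrite -sum1_card big_mkcond; apply: eq_bigr => k _; rewrite inE.
rewrite rk_valE -natz natr_sum mulr_sumr -sumrB; apply: eq_bigr => k _.
by rewrite !sg_full //; do 2 case: (_ \in _).
Qed.

(** * Linear functionals and convex hulls *)

Section Euclidean.
Variables (R : realFieldType) (n : nat).
Implicit Types (A B S T : {set elt n}) (F : {set {set elt n}}).
Implicit Types (c x y u v : 'rV[R]_n).

Lemma eSE S k : eS R S 0 k = (sg S k)%:~R.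
Proof. by rewrite mxE /sg intrB. Qed.

Lemma dotvDl c1 c2 x : dotv (c1 + c2) x = dotv c1 x + dotv c2 x.
Proof. by rewrite -big_split; apply: eq_bigr => k _; rewrite mxE mulrDl. Qed.

Lemma dotvZl a c x : dotv (a *: c) x = a * dotv c x.
Proof. by rewrite mulr_sumr; apply: eq_bigr => k _; rewrite mxE mulrA. Qed.

Lemma dotvC c x : dotv c x = dotv x c.
Proof. by apply: eq_bigr => k _; rewrite mulrC. Qed.

Lemma dotvDr c x y : dotv c (x + y) = dotv c x + dotv c y.
Proof. by rewrite !(dotvC c) dotvDl. Qed.

Lemma dotvZr c a x : dotv c (a *: x) = a * dotv c x.
Proof. by rewrite !(dotvC c) dotvZl. Qed.

Lemma dotvBr c x y : dotv c (x - y) = dotv c x - dotv c y.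
Proof. by rewrite -scaleN1r dotvDr dotvZr mulN1r. Qed.

Lemma dotv_sum c I r (P : pred I) (f : I -> 'rV[R]_n) :
  dotv c (\sum_(i <- r | P i) f i) = \sum_(i <- r | P i) dotv c (f i).
Proof.
apply: (big_morph _ (dotvDr c)).
by rewrite -(scale0r c) dotvZr mul0r.
Qed.

Lemma dotv_eS S B : dotv (eS R S) (eS R B) = (rk_val S B)%:~R.
Proof.
rewrite rk_valE rmorph_sum; apply: eq_bigr => k _.
by rewrite !eSE -intrM.
Qed.

Lemma eS_inj A B : full A -> full B -> eS R A = eS R B -> A = B.
Proof.
move=> fA fB /rowP eAB; apply: full_inj => // k; apply: (@intr_inj R).
by rewrite -!eSE.
Qed.

Lemma eS_full B k : full B -> eS R B 0 k = if (k, false) \in B then 1 else -1.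
Proof. by move=> fB; rewrite eSE sg_full //; case: ifP. Qed.

(** A large multiple of [f] makes the comparison lexicographic. The sum of all quotients of gaps
    bounds each of them, and the extra 1 makes the inequality strict. *)
Lemma lex_scale (I : finType) (f h : I -> R) :
  exists N : R, forall i j, f i < f j -> N * f i + h i < N * f j + h j.
Proof.
pose q (p : I * I) := `|h p.1 - h p.2| / `|f p.2 - f p.1|.
exists (1 + \sum_p q p) => i j fij.
have q0 p : 0 <= q p by rewrite divr_ge0.
have : q (i, j) <= \sum_p q p.
  by rewrite (bigD1 (i, j)) //= lerDl sumr_ge0.
have d0 : 0 < f j - f i by rewrite subr_gt0.
rewrite {1}/q /= (gtr0_norm d0) ler_pdivrMr // => le_q.
have := ler_norm (h i - h j); nra.
Qed.

Lemma in_conv_eS F B : B \in F -> in_conv F (eS R B).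
Proof.
move=> BF; exists (fun X => (X == B)%:R); split=> [X _||].
- exact: ler0n.
- by rewrite (bigD1 B) //= eqxx big1 ?addr0 // => X /andP[_ /negbTE->].
- rewrite (bigD1 B) //= eqxx scale1r big1 ?addr0 // => X /andP[_ /negbTE->].
  by rewrite scale0r.
Qed.

Lemma in_conv_le F c m x : (forall B, B \in F -> dotv c (eS R B) <= m) ->
  in_conv F x -> dotv c x <= m.
Proof.
move=> le_m [lam [lam0 lam1 ->]]; rewrite dotv_sum.
rewrite -[m]mul1r -lam1 mulr_suml ler_sum // => B BF.
by rewrite dotvZr ler_wpM2l ?lam0 ?le_m.
Qed.

(** Complementary slackness: the products of weight and gap [m - c.e_B] are nonnegative with sum at
    most 0, so all weight lies on maximizers. *)
Lemma in_conv_max F c m x : (forall B, B \in F -> dotv c (eS R B) <= m) ->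
  in_conv F x -> m <= dotv c x ->
  in_conv [set B in F | dotv c (eS R B) == m] x.
Proof.
move=> le_m [lam [lam0 lam1 xE]] le_mx.
have gap0 B : B \in F -> 0 <= lam B * (m - dotv c (eS R B)).
  by move=> BF; rewrite mulr_ge0 ?lam0 // subr_ge0 le_m.
have lamZ B : B \in F -> dotv c (eS R B) != m -> lam B = 0.
  move=> BF ne; apply/eqP.
  suff : lam B * (m - dotv c (eS R B)) == 0.
    by rewrite mulf_eq0 subr_eq0 [m == _]eq_sym (negbTE ne) orbF.
  have /eqP : \sum_(B in F) lam B * (m - dotv c (eS R B)) = 0.
    apply/eqP; rewrite eq_le sumr_ge0 // andbT.
    under eq_bigr do rewrite mulrBr -dotvZr.
    by rewrite sumrB -mulr_suml lam1 mul1r -dotv_sum -xE subr_le0.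
  by rewrite psumr_eq0 // => /allP /(_ B (mem_index_enum _)); rewrite BF.
exists lam; split.
- by move=> B; rewrite inE => /andP[/lam0].
- rewrite -lam1 [RHS](bigID (fun B => dotv c (eS R B) == m)) /=.
  rewrite [X in _ = _ + X]big1 ?addr0 => [|B /andP[]]; last exact: lamZ.
  by apply: eq_bigl => B; rewrite inE.
- rewrite xE (bigID (fun B => dotv c (eS R B) == m)) /=.
  rewrite [X in _ + X = _]big1 ?addr0 => [|B /andP[BF /lamZ->]] //.
    by apply: eq_bigl => B; rewrite inE.
  by rewrite scale0r.
Qed.

End Euclidean.

(** * Edges and their vertices *)

Section ConvexHullEdges.
Variables (R : realFieldType) (n : nat).
Implicit Types (A B S T : {set elt n}) (F : {set {set elt n}}).
Implicit Types (c x y u v : 'rV[R]_n).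

Lemma edge_intro F c A B : A \in F -> B \in F -> full A -> full B -> A != B ->
  dotv c (eS R B) = dotv c (eS R A) ->
  (forall X, X \in F -> dotv c (eS R X) <= dotv c (eS R A)) ->
  (forall X, X \in F -> dotv c (eS R X) = dotv c (eS R A) -> X = A \/ X = B) ->
  is_edge F (eS R A) (eS R B).
Proof.
move=> AF BF fA fB neAB cB cmax ceq; split.
  by apply: contra neAB => /eqP/(eS_inj fA fB)->.
exists c => x; split=> [[xF /(_ _ (in_conv_eS R AF)) cx]|[t [t0 t1 ->]]].
  have [lam [lam0 lam1 ->]] := in_conv_max cmax xF cx.
  have GE : [set X in F | dotv c (eS R X) == dotv c (eS R A)] = [set A; B].
    apply/setP => X; rewrite !inE; apply/andP/orP => [[XF /eqP /(ceq X XF)]|].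
      by case=> ->; rewrite eqxx; [left|right].
    by case=> /eqP->; rewrite ?AF ?BF ?cB eqxx.
  move: lam0 lam1; rewrite {}GE !big_setU1 ?inE //= !big_set1 => lam0 lam1.
  exists (lam B); split.
  - by rewrite lam0 // !inE eqxx orbT.
  - by rewrite -lam1 lerDr lam0 // !inE eqxx.
  - by rewrite -lam1 addrK.
have cE : dotv c ((1 - t) *: eS R A + t *: eS R B) = dotv c (eS R A).
  by rewrite dotvDr !dotvZr cB; ring.
split=> [|y yF]; last by rewrite cE; apply: in_conv_le yF.
exists (fun X => (1 - t) *+ (X == A) + t *+ (X == B)); split.
- by move=> X _; rewrite addr_ge0 // mulrn_wge0 // subr_ge0.
- rewrite big_split /= (bigD1 A) //= (bigD1 B BF) //= !eqxx !big1 /=;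
    first ring.
    by move=> X /andP[_ /negbTE->].
  by move=> X /andP[_ /negbTE->].
- under eq_bigr do rewrite scalerDl.
  rewrite big_split /= (bigD1 A) //= (bigD1 B BF) //= !eqxx !big1 ?addr0 //.
    by move=> X /andP[_ /negbTE->]; rewrite scale0r.
  by move=> X /andP[_ /negbTE->]; rewrite scale0r.
Qed.

Lemma in_conv_cube F x k : (forall B, B \in F -> full B) -> in_conv F x ->
  -1 <= x 0 k <= 1.
Proof.
move=> fF [lam [lam0 lam1 ->]]; rewrite summxE -ler_norml -lam1.
apply: le_trans (ler_norm_sum _ _ _) _; apply: ler_sum => B BF.
rewrite mxE normrM ger0_norm ?lam0 // eS_full ?fF //.
by case: ifP => _; rewrite ?normrN normr1 mulr1.
Qed.

(** 1 and -1 are extreme in [-1,1], so a segment inside it meets both only at its two ends. Each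
    equation becomes a vanishing sum of two nonnegative products. *)
Lemma segment_ends (s t u v : R) :
  0 <= s -> s <= 1 -> 0 <= t -> t <= 1 ->
  -1 <= u -> u <= 1 -> -1 <= v -> v <= 1 ->
  1 = (1 - s) * u + s * v -> -1 = (1 - t) * u + t * v ->
  s = 0 /\ t = 1 \/ s = 1 /\ t = 0.
Proof.
move=> s0 s1 t0 t1 u0 u1 v0 v1 es et.
have zero (a b c d : R) : 0 <= a -> 0 <= b -> 0 <= c -> 0 <= d ->
    a * b + c * d = 0 -> (a = 0 \/ b = 0) /\ (c = 0 \/ d = 0).
  move=> a0 b0 c0 d0 /eqP; rewrite paddr_eq0 ?mulr_ge0 // !mulf_eq0.
  by case/andP=> /orP[]/eqP-> /orP[]/eqP->; split; auto.
have [su sv] : (1 - s = 0 \/ 1 - u = 0) /\ (s = 0 \/ 1 - v = 0).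
  by apply: zero; lra.
have [tu tv] : (1 - t = 0 \/ 1 + u = 0) /\ (t = 0 \/ 1 + v = 0).
  by apply: zero; lra.
case: su => su; [case: sv => sv; [lra|]; case: tv => tv; [right; lra|lra]|].
by case: tu => tu; [case: tv => tv; [lra|]; case: sv => sv; [left; lra|lra]|lra].
Qed.

(** The face is the hull of the maximizers of [c]. It is not a point, so there are two of them; any
    two occupy opposite ends of the segment, which leaves no room for a third. *)
Lemma edge_elim F u v : (forall B, B \in F -> full B) -> F != set0 ->
  is_edge F u v ->
  exists c A B, [/\ A \in F, B \in F, A != B, u = eS R A & v = eS R B] /\
    dotv c (eS R B) = dotv c (eS R A) /\
    (forall X, X \in F -> X != A -> X != B ->
       dotv c (eS R X) < dotv c (eS R A)).
Proof.
move=> fF /set0Pn[B1 B1F] [neuv [c face]].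
pose f B := dotv c (eS R B).
have [B0 B0F f_le] : exists2 B0, B0 \in F & forall X, X \in F -> f X <= f B0.
  by case: (arg_maxP f B1F) => B0 B0F f_le; exists B0.
pose G := [set X in F | dotv c (eS R X) == f B0].
have face_conv x : in_face F c x -> in_conv G x.
  case=> xF /(_ _ (in_conv_eS R B0F)) cx.
  exact: (in_conv_max f_le xF cx).
have uG : in_conv G u.
  apply: face_conv; apply/face; exists 0; split=> //.
  by rewrite subr0 scale1r scale0r addr0.
have vG : in_conv G v.
  apply: face_conv; apply/face; exists 1; split=> //.
  by rewrite subrr scale1r scale0r add0r.
have fG B : B \in G -> full B by rewrite inE => /andP[/fF].
have seg X : X \in G -> in_segment u v (eS R X).
  rewrite inE => /andP[XF /eqP fX]; apply/face; split; first exact: in_conv_eS.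
  by move=> y; rewrite fX; apply: in_conv_le.
(* a vertex of the cube is not interior to a segment of the cube *)
have ends X Y : X \in G -> Y \in G -> X != Y ->
    eS R X = u /\ eS R Y = v \/ eS R X = v /\ eS R Y = u.
  move=> XG YG neXY.
  have [k neXYk] : exists k, eS R X 0 k != eS R Y 0 k.
    apply/existsP; apply: contraNT neXY; rewrite negb_exists => /forallP eXY.
    apply/eqP/(@eS_inj R); rewrite ?fG //.
    by apply/rowP => k; apply/eqP; rewrite -[_ == _]negbK.
  have [s [s0 s1 Xs]] := seg X XG; have [t [t0 t1 Yt]] := seg Y YG.
  have /andP[u0 u1] := in_conv_cube k fG uG.
  have /andP[v0 v1] := in_conv_cube k fG vG.
  have Xk : eS R X 0 k = (1 - s) * u 0 k + s * v 0 k by rewrite Xs !mxE.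
  have Yk : eS R Y 0 k = (1 - t) * u 0 k + t * v 0 k by rewrite Yt !mxE.
  move: neXYk Xk Yk; rewrite !eS_full ?fG //.
  have E0 (r : R) : r = 0 -> (1 - r) *: u + r *: v = u.
    by move=> ->; rewrite subr0 scale1r scale0r addr0.
  have E1 (r : R) : r = 1 -> (1 - r) *: u + r *: v = v.
    by move=> ->; rewrite subrr scale1r scale0r add0r.
  have st : s = 0 /\ t = 1 \/ s = 1 /\ t = 0 ->
      eS R X = u /\ eS R Y = v \/ eS R X = v /\ eS R Y = u.
    by case=> -[s_ t_]; [left|right]; rewrite Xs Yt;
      [rewrite (E0 s) ?(E1 t)|rewrite (E1 s) ?(E0 t)].
  case: ifP => _; case: ifP => _; rewrite ?eqxx // => _ Xk Yk; apply: st.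
    exact: (segment_ends (u := u 0 k) (v := v 0 k)).
  (* Here X has coordinate -1 and Y has 1, so the lemma is applied to the negated coordinate. *)
  apply: (segment_ends (u := - u 0 k) (v := - v 0 k)); lra.
have [Y YG neY] : exists2 Y, Y \in G & Y != B0.
  apply/exists_inP; apply: contraNT neuv.
  rewrite negb_exists_in => /forall_inP eqB0.
  have G1 x : in_conv G x -> x = eS R B0.
    case=> lam [_ lam1 ->]; rewrite -[RHS]scale1r -lam1 scaler_suml.
    by apply: eq_bigr => Y /eqB0; rewrite negbK => /eqP->.
  by rewrite (G1 u) // (G1 v).
have B0G : B0 \in G by rewrite inE B0F /= eqxx.
suff [A [B [AG BG neAB [uE vE]]]] : exists A B,
    [/\ A \in G, B \in G, A != B & u = eS R A /\ v = eS R B].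
  move: (AG) (BG); rewrite !inE => /andP[AF /eqP fA] /andP[BF /eqP fB].
  exists c, A, B; split=> //; split=> [|X XF neXA neXB]; first by rewrite fA fB.
  rewrite lt_neqAle fA f_le // andbT; apply/negP => fX.
  have XG : X \in G by rewrite inE XF fX.
  (* X and A sit at opposite ends; A is at [u], so X is at [v], where B is. *)
  case: (ends X A XG AG neXA) => -[XE AE].
    by case/eqP: neuv; rewrite uE.
  move/negP: neXB; apply; apply/eqP/(@eS_inj R); rewrite ?fG //.
  by rewrite XE vE.
case: (ends B0 Y B0G YG); rewrite 1?eq_sym // => -[B0E YE].
  by exists B0, Y; rewrite eq_sym.
by exists Y, B0.
Qed.

(** The separating function [phi] is left arbitrary for two uses: the value of [e_T] among
    maximizers of a mixed functional, and parity with [c = 0], where all of F is maximal. *)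
Lemma edge_sep F c (I : eqType) (phi : {set elt n} -> I) A0 B0 :
  (forall B, B \in F -> full B) -> A0 \in F -> B0 \in F ->
  (forall X, X \in F -> dotv c (eS R X) <= dotv c (eS R A0)) ->
  dotv c (eS R B0) = dotv c (eS R A0) -> phi A0 != phi B0 ->
  exists A B, [/\ A \in F, B \in F, phi A != phi B,
    dotv c (eS R A) = dotv c (eS R A0) /\
    dotv c (eS R B) = dotv c (eS R A0) & is_edge F (eS R A) (eS R B)].
Proof.
move=> fF A0F B0F cmax cB0 neAB0.
pose f B := dotv c (eS R B).
pose P (p : {set elt n} * {set elt n}) := [&& p.1 \in F, p.2 \in F,
  phi p.1 != phi p.2, f p.1 == f A0 & f p.2 == f A0].
have P0 : P (A0, B0) by rewrite /P /= A0F B0F neAB0 /f cB0 eqxx.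
case: (arg_minnP (fun p => #|diff p.1 p.2|) P0) => -[A B] /=.
case/and5P => /= AF BF neAB /eqP fA /eqP fB minAB.
exists A, B; split=> //.
have [fuA fuB] := (fF A AF, fF B BF).
(* [d] is 0 where A and B differ and twice their common sign elsewhere, so on the cube it is maximal
   exactly at the vertices of the subcube spanned by A and B. *)
pose d : 'rV[R]_n := eS R A + eS R B.
have dE k : d 0 k = eS R A 0 k + eS R B 0 k by rewrite /d [LHS]mxE.
(* [N *: c + d] maximizes [c] first and breaks ties by [d]. *)
have [N Nlt] := lex_scale f (fun X => dotv d (eS R X)).
have dle X k : X \in F -> d 0 k * eS R X 0 k <= d 0 k * eS R A 0 k.
  move=> /fF fX; rewrite dE !eS_full //; do 3 case: ifP => _; lra.
have dB : dotv d (eS R B) = dotv d (eS R A).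
  apply: eq_bigr => k _; rewrite dE !eS_full //.
  by do 2 case: ifP => _; lra.
have deq X : X \in F -> f X = f A0 -> dotv d (eS R X) = dotv d (eS R A) ->
    X = A \/ X = B.
  move=> XF fX dX; have fuX := fF X XF.
  (* Equality of the sums, with an inequality in each coordinate, gives equality in each
     coordinate. *)
  have sub k : sg A k = sg B k -> sg X k = sg A k.
    move/eqP: dX; rewrite /dotv eq_sym -subr_eq0 -sumrB psumr_eq0; last first.
      by move=> j _; rewrite subr_ge0 dle.
    move/allP/(_ k (mem_index_enum _)); rewrite dE !eS_full // !sg_full //.
    do 3 (case: ifP => _ //); rewrite implyTb => /eqP h // _; exfalso; lra.
  have [->|neXA] := eqVneq X A; first by left.
  have [->|neXB] := eqVneq X B; first by right.
  have closer Y Z : full Y -> full Z -> X != Z ->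
      (forall k, sg Y k = sg Z k -> sg X k = sg Y k) ->
      (#|diff Y X| < #|diff Y Z|)%N.
    move=> fY fZ neXZ subX; apply/proper_card/properP; split.
      apply/subsetP => k; rewrite !inE; apply: contra => /eqP/subX->.
      exact: eqxx.
    have [k kXZ] : exists k, sg X k != sg Z k.
      apply/existsP; apply: contraNT neXZ; rewrite negb_exists => /forallP h.
      by apply/eqP/full_inj => // k; apply/eqP; rewrite -[_ == _]negbK.
    exists k; rewrite !inE ?negbK.
      by apply: contra kXZ => /eqP e; rewrite (subX k e) e.
    move: kXZ (subX k); rewrite !sg_full //.
    by do 3 case: ifP => _ // ; move=> _ /(_ erefl).
  (* [phi X] differs from [phi A] or from [phi B]; either way X completes a closer separated
     pair. *)
  have [eAX|neAX] := eqVneq (phi A) (phi X).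
    have : P (B, X) by rewrite /P /= BF XF -eAX eq_sym neAB fB fX eqxx.
    move/minAB; rewrite leqNgt /= (diffC A) closer // => k e.
    by rewrite e; apply: sub.
  have : P (A, X) by rewrite /P /= AF XF neAX fA fX eqxx.
  by move/minAB; rewrite leqNgt /= closer.
have cdE X : dotv (N *: c + d) (eS R X) = N * f X + dotv d (eS R X).
  by rewrite dotvDl dotvZl.
apply: (@edge_intro _ (N *: c + d)) => //.
- by apply: contra neAB => /eqP->.
- by rewrite !cdE fA fB dB.
- move=> X XF; rewrite !cdE fA.
  have := cmax X XF; rewrite le_eqVlt => /orP[/eqP eX|lt]; last first.
    by apply: ltW; rewrite -fA; apply: Nlt; rewrite fA.
  by rewrite /f eX lerD2l; apply: ler_sum => k _; apply: dle.
- move=> X XF; rewrite !cdE fA.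
  have := cmax X XF; rewrite le_eqVlt => /orP[/eqP eX|lt].
    by rewrite /f eX => /addrI; apply: deq.
  by move=> e; have := Nlt X A; rewrite fA => /(_ lt); rewrite e ltxx.
Qed.
End ConvexHullEdges.

(** * Common maximizers on a chain and bisubmodularity *)

Section Chain.
Variables (R : realFieldType) (n : nat).
Implicit Types (A B S T : {set elt n}) (F : {set {set elt n}}).
Implicit Types (c x y u v w : 'rV[R]_n).

Lemma eS_sub S T k : S \subset T -> admissible T ->
  eS R S 0 k = 0 \/ eS R S 0 k = eS R T 0 k.
Proof.
move=> /subsetP sST /forallP /(_ k); rewrite !eSE /sg.
move: (sST (k, false)) (sST (k, true)).
do 4 case: (_ \in _); move=> h1 h2 h;
  first [by left | by right | by have := h1 isT | by have := h2 isT | by []].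
Qed.

Lemma eS_cases T k : eS R T 0 k = 0 \/ eS R T 0 k = 1 \/ eS R T 0 k = -1.
Proof. by rewrite eSE /sg; do 2 case: (_ \in _); auto. Qed.

Lemma dotv_ev c i : dotv c (ev R i) = c 0 i.
Proof.
rewrite /dotv (bigD1 i) //= mxE eqxx mulr1 big1 ?addr0 // => k /negbTE ne.
by rewrite mxE ne mulr0.
Qed.

(* A root is nonnegative or nonpositive on a whole closed Weyl chamber, and
   the vectors [eS S], [eS T] of a chain lie in a common chamber *)
Lemma dm_dir_chain S T w : S \subset T -> admissible T -> dm_dir w ->
  0 <= dotv (eS R S) w * dotv (eS R T) w.
Proof.
move=> sST aT.
have root d : 0 <= dotv (eS R S) d * dotv (eS R T) d -> parallel w d ->
    0 <= dotv (eS R S) w * dotv (eS R T) w.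
  move=> h [l ->]; rewrite !dotvZr mulrACA mulr_ge0 //.
  by rewrite -expr2 sqr_ge0.
have S_T k := eS_sub k sST aT.
case=> [[i]|[i [j [_ [] ]]]]; apply: root;
  rewrite 2?dotvBr 2?dotvDr !dotv_ev.
- by case: (S_T i) => ->; rewrite ?mul0r // -expr2 sqr_ge0.
- by case: (S_T i) => ->; case: (S_T j) => ->;
    case: (eS_cases T i) => [|[]] ->; case: (eS_cases T j) => [|[]] ->; lra.
- by case: (S_T i) => ->; case: (S_T j) => ->;
    case: (eS_cases T i) => [|[]] ->; case: (eS_cases T j) => [|[]] ->; lra.
Qed.

Lemma chain_common_max F S T : F != set0 -> (forall B, B \in F -> full B) ->
  (forall u v, is_edge F u v -> dm_dir (u - v)) ->
  S \subset T -> admissible T ->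
  exists2 B, B \in F & forall X, X \in F ->
    rk_val S X <= rk_val S B /\ rk_val T X <= rk_val T B.
Proof.
move=> /set0Pn[B1 B1F] fF edgeF sST aT.
pose a X := dotv (eS R S) (eS R X); pose b X := dotv (eS R T) (eS R X).
have [A AF aA] : exists2 A, A \in F & forall X, X \in F -> a X <= a A.
  by case: (arg_maxP a B1F) => A AF aA; exists A.
pose PA X := (X \in F) && (a X == a A).
have PAA : PA A by rewrite /PA AF eqxx.
(* B is the best candidate: it maximizes [b] among the maximizers of [a]. *)
case: (arg_maxP b PAA) => B /andP[BF /eqP aB] bB {PAA}.
suff bmax X : X \in F -> b X <= b B.
  exists B => // X XF; split; rewrite -(ler_int R) -!dotv_eS; last exact: bmax.
  by rewrite -/(a X) -/(a B) aB aA.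
move=> XF; rewrite leNgt; apply/negP => bBX.
(* [q Y] is the value of t at which Y catches up with B under [a + t b]; B remains a maximizer up to
   the smallest such t. *)
pose q Y := (a B - a Y) / (b Y - b B).
pose PY Y := (Y \in F) && (b B < b Y).
have PX : PY X by rewrite /PY XF.
case: (arg_minP q PX) => Y /andP[YF bBY] qmin {PX bBX XF X}.
(* Strictness comes from the choice of B and makes the critical t positive. *)
have aYB : a Y < a B.
  rewrite lt_neqAle aB aA // andbT; apply/negP => aYA.
  have PAY : PA Y by rewrite /PA YF.
  by have := le_lt_trans (bB Y PAY) bBY; rewrite ltxx.
have t0 : 0 < q Y by rewrite divr_gt0 ?subr_gt0.
have qE Z : b B < b Z -> q Z * (b Z - b B) = a B - a Z.
  by move=> lt; rewrite /q divfK // subr_eq0 gt_eqF.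
pose c := eS R S + q Y *: eS R T.
have cE Z : dotv c (eS R Z) = a Z + q Y * b Z by rewrite dotvDl dotvZl.
have cB Z : Z \in F -> dotv c (eS R Z) <= dotv c (eS R B).
  move=> ZF; rewrite !cE; have [lt|le] := ltP (b B) (b Z).
    have PZ : PY Z by rewrite /PY ZF.
    have leq : q Y <= q Z := qmin Z PZ; have := qE _ lt; nra.
  by have := aA Z ZF; rewrite -aB; nra.
have cY : dotv c (eS R Y) = dotv c (eS R B).
  by rewrite !cE; have := qE _ bBY; lra.
have neb : b B != b Y by rewrite lt_eqF.
have [D [E [_ _ neDE [cD cEq] edge]]] := edge_sep fF BF YF cB cY neb.
have := dm_dir_chain sST aT (edgeF _ _ edge).
rewrite !dotvBr -/(a D) -/(a E) -/(b D) -/(b E).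
move: cD; rewrite -cEq !cE => eDE.
(* The functional is constant along the edge, so the changes of [a] and [b] have strictly opposite
   signs, against [dm_dir_chain]. *)
have -> : a D - a E = - (q Y * (b D - b E)) by lra.
rewrite mulNr -mulrA oppr_ge0 leNgt mulr_gt0 //.
by rewrite -expr2 exprn_even_gt0 //= subr_eq0.
Qed.

Lemma dm_bisubmodular F (g : {set elt n} -> int) S T :
  is_delta_matroid R F -> is_rank_fun F g -> admissible S -> admissible T ->
  g (S :&: T) + g (sqcup S T) <= g S + g T.
Proof.
move=> [F0 bF edgeF] gF aS aT.
have fF B : B \in F -> full B by move=> /bF h; apply/fullP.
have [B BF maxB] := chain_common_max F0 fF edgeF (setI_sub_sqcup aS aT)
  (adm_sqcup S T).
have aI : admissible (S :&: T) := sub_adm (subsetIl _ _) aS.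
have [[C CF ->] _] := gF _ aI.
have [[D DF ->] _] := gF _ (adm_sqcup S T).
have [leC _] := maxB C CF; have [_ leD] := maxB D DF.
apply: le_trans (lerD leC leD) _; rewrite rk_setI_sqcup //.
by apply: lerD; [case: (gF _ aS)|case: (gF _ aT)] => _ ->.
Qed.

End Chain.

(** * The greedy algorithm for submodular functions *)

Lemma submodular_greedy (T : finType) (h : {set T} -> int) (U S : {set T}) :
  h set0 = 0 ->
  (forall A B : {set T}, A \subset U -> B \subset U ->
     h (A :&: B) + h (A :|: B) <= h A + h B) ->
  S \subset U ->
  exists x : T -> int,
    [/\ \sum_(a in S) x a = h S, \sum_(a in U) x a = h U,
        forall A : {set T}, A \subset U -> \sum_(a in A) x a <= h A &
        forall a, a \in U -> exists A : {set T},
          [/\ A \subset U, a \notin A & x a = h (a |: A) - h A]].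
Proof.
move=> h0; have [m] := ubnP #|U|; elim: m U S => // m IHm U S ltUm hsub sSU.
have [U0|U0] := eqVneq U set0.
  move: sSU; rewrite U0 subset0 => /eqP->; exists (fun=> 0).
  rewrite big_set0 h0; split=> // [A|a]; last by rewrite inE.
  by rewrite subset0 => /eqP->; rewrite big_set0 h0.
(* [a] comes last in the greedy order. Taking it outside S whenever possible keeps S an initial
   segment, which makes S tight. *)
have [a aU aS] : exists2 a, a \in U & S != U -> a \notin S.
  have [->|neSU] := eqVneq S U; first by case/set0Pn: U0 => a; exists a.
  have : S \proper U by rewrite properEneq neSU.
  by case/properP => _ [a aU aS]; exists a.
have ltU'm : (#|U :\ a| < m)%N.
  by move: ltUm; rewrite (cardsD1 a) aU.
have sU'U : U :\ a \subset U := subsetDl _ _.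
have [||x [xS xU xle xh]] := IHm (U :\ a) (S :\ a) ltU'm.
- by move=> A B sA sB; apply: hsub;
    [apply: subset_trans sA _|apply: subset_trans sB _].
- exact: setSD.
pose y b := if b == a then h U - h (U :\ a) else x b.
have yE (A : {set T}) : a \notin A -> \sum_(b in A) y b = \sum_(b in A) x b.
  move=> aA; apply: eq_bigr => b bA; rewrite /y.
  by case: eqP bA aA => // -> -> .
have yD (A : {set T}) : a \in A ->
    \sum_(b in A) y b = h U - h (U :\ a) + \sum_(b in A :\ a) x b.
  by move=> aA; rewrite (big_setD1 a) //= yE ?setD11 // {1}/y eqxx.
have yU : \sum_(b in U) y b = h U by rewrite yD // xU subrK.
exists y; split=> //.
- have [->//|/aS aS'] := eqVneq S U; rewrite yE //.
  by move: xS; rewrite (setDidPl _) // disjoint_sym disjoints1.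
- move=> A sAU; have [aA|aA] := boolP (a \in A); last first.
    by rewrite yE // xle // subsetD1 sAU.
  (* Submodularity for A and [U :\ a], whose intersection is [A :\ a] and whose union is U, bounds
     the last increment by that of A. *)
  rewrite yD //; have := hsub A (U :\ a) sAU sU'U.
  have -> : A :&: (U :\ a) = A :\ a.
    by rewrite setIDA (setIidPl sAU).
  have -> : A :|: (U :\ a) = U.
    apply/eqP; rewrite eqEsubset subUset sAU sU'U /=.
    by apply/subsetP => b bU; rewrite !inE bU andbT;
      case: eqP => [->|]; rewrite ?aA ?orbT.
  have := xle (A :\ a) (setSD _ sAU); lia.
- move=> b bU; have [->|ne] := eqVneq b a.
    exists (U :\ a); rewrite setD11 sU'U setD1K //; split=> //.
    by rewrite /y eqxx.
  have [|A [sA bA xb]] := xh b; first by rewrite !inE ne.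
  exists A; rewrite bA /y (negbTE ne); split=> //.
  exact: subset_trans sA _.
Qed.

(** * Feasible sets of a bisubmodular function *)

Lemma rk_card n (S B : {set elt n}) : full B ->
  rk_val S B = #|S|%:Z - 2 * #|S :\: B|%:Z.
Proof.
move=> fB; rewrite /rk_val.
have -> : barset S :&: B = barset (S :\: B).
  by apply/setP => a;
    rewrite in_setI !in_barset in_setD (full_bar _ fB) negbK andbC.
rewrite card_imset; last exact: inv_inj (@barK n).
by move: (cardsID B S); rewrite /reverse_coercion; lia.
Qed.

Lemma rk_setU1 n (S B : {set elt n}) a : full B -> a \notin S ->
  rk_val (a |: S) B = rk_val S B + (if a \in B then 1 else -1).
Proof.
move=> fB aS; rewrite !rk_val_sum big_setU1 //= full_bar // addrC.
by case: (a \in B).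
Qed.

(** The symmetric exchange axiom of delta-matroids: flipping [i] in A, with at most one further flip
    inside [diff A B], stays in F. *)
Definition exchange n (F : {set {set elt n}}) : Prop :=
  forall A B i, A \in F -> B \in F -> i \in diff A B ->
    exists X, [/\ X \in F, i \in diff X A, diff X A \subset diff A B &
      (#|diff X A| <= 2)%N].

Lemma odd_step (x y : int) (m : nat) :
  (x = m %[mod 2])%Z -> (y = m.+1 %[mod 2])%Z -> x <= y + 1 -> y <= x + 1 ->
  y - x = 1 \/ y - x = -1.
Proof. lia. Qed.

Section Rank.
Variables (n : nat) (g : {set elt n} -> int).
Hypothesis g0 : g set0 = 0.
Hypothesis g1 : forall S, admissible S -> #|S| = 1%N -> `|g S| <= 1.
Hypothesis g2 : forall S T, admissible S -> admissible T ->
  g S + g T >= g (S :&: T) + g (sqcup S T).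
Hypothesis g3 : forall S, admissible S -> (g S = (#|S|)%:Z %[mod 2])%Z.
Implicit Types (A B S T U : {set elt n}).

Definition feasible : {set {set elt n}} :=
  [set B | full B && [forall S, admissible S ==> (rk_val S B <= g S)]].

Lemma feasibleP B : reflect
  (full B /\ forall S, admissible S -> rk_val S B <= g S) (B \in feasible).
Proof.
rewrite inE; apply: (iffP andP) => -[fB h]; split=> //.
  by move=> S aS; move/forallP/(_ S)/implyP: h; apply.
by apply/forallP => S; apply/implyP/h.
Qed.

Lemma adm1 (a : elt n) : admissible [set a].
Proof.
apply/forallP => k; rewrite !inE; case: a => i b.
by rewrite /eq_op /=; case: b; rewrite ?andbF ?andbT ?andNb.
Qed.

(** Bisubmodularity of A with [[set a]] bounds the increment above by 1. That of [a |: A] with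
    [[set bar a]], where [sqcup] cancels [a], bounds it below by -1. Parity excludes 0. *)
Lemma marginal U A a : full U -> A \subset U -> a \in U -> a \notin A ->
  g (a |: A) - g A = 1 \/ g (a |: A) - g A = -1.
Proof.
move=> fU sAU aU aA; have [aU' _] := fullP _ fU.
have saAU : a |: A \subset U by rewrite subUset sub1set aU.
have [admA admaA] := (sub_adm sAU aU', sub_adm saAU aU').
have bU : bar a \notin U by rewrite full_bar // aU.
have bA : bar a \notin A by apply: contra bU; apply: (subsetP sAU).
have ne : bar a != a by apply: contra bU => /eqP->.
have le1 b : `|g [set b]| <= 1 by rewrite g1 ?adm1 ?cards1.
have up : g (a |: A) <= g A + g [set a].
  have := g2 admA (adm1 a).
  have -> : A :&: [set a] = set0.
    by apply/eqP; rewrite setI_eq0 disjoint_sym disjoints1.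
  rewrite g0 add0r; congr (g _ <= _); apply/setP => b.
  rewrite /sqcup !inE orbC; case: (eqVneq b a) => [->|neb] /=.
    by rewrite (negbTE bA) (negbTE ne).
  have [bA'|//] := boolP (b \in A); rewrite /= negb_or (admP admA) //=.
  by apply: contra bA => /eqP<-; rewrite barK.
have down : g A <= g (a |: A) + g [set bar a].
  have := g2 admaA (adm1 (bar a)).
  have -> : (a |: A) :&: [set bar a] = set0.
    by apply/eqP; rewrite setI_eq0 disjoint_sym disjoints1 !inE negb_or ne.
  rewrite g0 add0r; congr (g _ <= _); apply/setP => b; rewrite /sqcup !inE.
  have [->|neb] := eqVneq b a; first by rewrite !eqxx !orbT andbF (negbTE aA).
  have [->|neb'] := eqVneq b (bar a).
    by rewrite barK eqxx andbF (negbTE bA).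
  rewrite /= !orbF; have [bA'|//] := boolP (b \in A).
  rewrite /= (negbTE (admP admA bA')) orbF (inj_eq (inv_inj (@barK n))).
  by rewrite (negbTE neb) orbF; apply: contra neb' => /eqP<-; rewrite barK.
have := g3 admaA; rewrite cardsU1 aA add1n => gA.
apply: odd_step (g3 admA) gA _ _.
  by apply: le_trans down _; rewrite lerD2l; apply: le_trans (ler_norm _) (le1 _).
by apply: le_trans up _; rewrite lerD2l; apply: le_trans (ler_norm _) (le1 _).
Qed.

Lemma feasible_tight S U : full U -> S \subset U ->
  exists2 B, B \in feasible & rk_val S B = g S /\ rk_val U B = g U.
Proof.
move=> fU sSU; have [aU _] := fullP _ fU.
have [|x [xS xU xle xm]] := @submodular_greedy _ g U S g0 _ sSU.
  move=> A B sA sB; have [admA admB] := (sub_adm sA aU, sub_adm sB aU).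
  apply: le_trans (g2 admA admB); rewrite lerD2l le_eqVlt; apply/orP; left.
  (* Inside an admissible U nothing cancels, so [sqcup] is the union and [g] is submodular. *)
  apply/eqP; congr (g _); apply/setP => a; rewrite [RHS]inE.
  have [aAB|//] := boolP (a \in A :|: B); rewrite /=.
  apply/esym; have : A :|: B \subset U by rewrite subUset sA.
  by move/sub_adm/(_ aU)/admP; apply.
have x1 a : a \in U -> x a = 1 \/ x a = -1.
  by move=> aU'; have [A [sA aA ->]] := xm a aU'; apply: (marginal fU sA aU' aA).
(* The greedy values are 1 or -1: 1 puts the element of U into B, -1 puts its bar there. *)
pose B : {set elt n} := [set a | if a \in U then x a == 1 else x (bar a) != 1].
have fB : full B.
  apply/forallP => k; rewrite !inE /bar /=.
  by move/forallP/(_ k): fU; do 2 case: (_ \in U); case: (x _ == 1).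
have rkB A : A \subset U -> rk_val A B = \sum_(a in A) x a.
  move=> /subsetP sAU; rewrite rk_val_sum; apply: eq_bigr => a /sAU aU'.
  by rewrite full_bar // !inE aU'; case: (x1 a aU') => ->.
have rkS : rk_val S B = g S by rewrite rkB.
have rkU : rk_val U B = g U by rewrite rkB.
exists B => //; apply/feasibleP; split=> // T aT.
(* For arbitrary T, both [T :&: U] and [sqcup T U] lie in U, where the greedy bound holds. As U is
   tight, bisubmodularity of T and U bounds [rk_val T B] by [g T]. *)
have sI : T :&: U \subset U := subsetIr _ _.
have sQ : sqcup T U \subset U.
  apply/subsetP => a; rewrite !inE negb_or => /and3P[_ _].
  by rewrite full_bar // negbK.
have := g2 aT aU; have := rk_setI_sqcup B aT aU.
have := xle _ sI; have := xle _ sQ; rewrite -!rkB //; lia.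
Qed.

Lemma feasible_rank : is_rank_fun feasible g.
Proof.
move=> S aS; split; last by move=> B /feasibleP[_]; apply.
(* S is completed to a full set by unbarred elements. *)
pose U := S :|: [set a : elt n | ~~ a.2 && (bar a \notin S) ].
have fU : full U.
  apply/forallP => k; rewrite !inE /bar /= orbF.
  by move/forallP/(_ k): aS; do 2 case: (_ \in S).
by have [B BF [rS _]] := feasible_tight fU (subsetUl _ _); exists B.
Qed.

Lemma feasible_exchange : exchange feasible.
Proof.
move=> A B i /feasibleP[fA Ag] /feasibleP[fB Bg] iAB.
pose U : {set elt n} := [set a | if a.1 == i then a \in B else a \in A].
have fU : full U.
  apply/forallP => k; rewrite !inE /=.
  by case: eqP => _; [move/forallP: fB|move/forallP: fA]; apply.
have [X XF [rS rU]] := feasible_tight fU (subsetIl U B).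
have /feasibleP[fX _] := XF.
have [aU _] := fullP _ fU.
have aS : admissible (U :&: B) := sub_adm (subsetIl _ _) aU.
(* B contains [U :&: B], so [g] there is at least its cardinality; X is tight there and must contain
   it too. *)
have sSX : U :&: B \subset X.
  have := Bg _ aS; rewrite -rS !rk_card //.
  have -> : (U :&: B) :\: B = set0 by apply/eqP; rewrite setD_eq0 subsetIr.
  by rewrite cards0 -setD_eq0 -cards_eq0; lia.
have agree k : sg U k = sg B k -> sg X k = sg B k.
  have := subsetP sSX (k, true); have := subsetP sSX (k, false); rewrite !in_setI.
  move: fX fU fB => /forallP/(_ k) + /forallP/(_ k) + /forallP/(_ k); rewrite /sg.
  do 6 case: (_ \in _); move=> h1 h2 h3 h4 h5 h6;
    by first [done | have := h4 isT | have := h5 isT].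
have sgU k : sg U k = if k == i then sg B k else sg A k.
  by rewrite /sg !inE /=; case: eqP.
move: iAB; rewrite inE => iAB.
(* X is tight at U, hence at least as close to U as A is, and A is at distance at most 1. *)
have le1 : (#|diff U X| <= 1)%N.
  have : rk_val U A <= g U by apply: Ag.
  rewrite -rU !rk_full //.
  have : (#|diff U A| <= 1)%N.
    rewrite -(cards1 i); apply/subset_leq_card/subsetP => k.
    by rewrite !inE sgU; case: (k == i) => //; rewrite eqxx.
  lia.
exists X; split=> //.
- by rewrite inE agree ?sgU ?eqxx // eq_sym.
- apply/subsetP => k; rewrite !inE; apply: contra => /eqP e.
  by rewrite agree ?e // sgU e; case: ifP.
- apply: (@leq_trans #|i |: diff U X|).
    apply/subset_leq_card/subsetP => k; rewrite !inE sgU.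
    by case: (k == i) => //=; rewrite eq_sym.
  by rewrite cardsU1; case: (_ \in _); lia.
Qed.

End Rank.

(** * From the exchange axiom to edge directions *)

Section Edges.
Variables (R : realFieldType) (n : nat).
Implicit Types (A B S T X : {set elt n}) (F : {set {set elt n}}).
Implicit Types (c x y u v w : 'rV[R]_n).

Lemma in_diff A B k : (k \in diff A B) = (eS R A 0 k != eS R B 0 k).
Proof. by rewrite inE !eSE (inj_eq (@intr_inj R)). Qed.

Lemma eSB A B k : (eS R A - eS R B) 0 k = eS R A 0 k - eS R B 0 k.
Proof. by rewrite [LHS]mxE [X in _ + X = _]mxE. Qed.

Lemma eS_opp A B k : full A -> full B -> k \in diff A B ->
  eS R B 0 k = - eS R A 0 k.
Proof.
move=> fA fB; rewrite in_diff !eS_full //.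
by do 2 case: (_ \in _); rewrite ?eqxx ?opprK.
Qed.

Lemma diff_neq0 A B : full A -> full B -> A != B -> exists k, k \in diff A B.
Proof.
move=> fA fB neAB; apply/existsP; apply: contraNT neAB.
rewrite negb_exists => /forallP h; apply/eqP/full_inj => // k.
by apply/eqP; move: (h k); rewrite inE negbK.
Qed.

Lemma dotvB_diff c X A : dotv c (eS R X) - dotv c (eS R A) =
  \sum_(k in diff X A) c 0 k * (eS R X 0 k - eS R A 0 k).
Proof.
rewrite -sumrB [RHS]big_mkcond; apply: eq_bigr => k _.
rewrite in_diff -mulrBr; case: eqP => //= ->.
by rewrite subrr mulr0.
Qed.

(** Exchanging at [i] gains [2 * |c_i|], and the possible second flip loses at most as much because
    [|c_i|] is maximal. X differs from A in at most two places, so it is not B. *)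
Lemma exchange_third F c A B i : (forall X, X \in F -> full X) -> exchange F ->
  A \in F -> B \in F -> i \in diff A B ->
  (forall j, j \in diff A B -> `|c 0 j| <= `|c 0 i|) ->
  0 <= c 0 i * eS R B 0 i -> (2 < #|diff A B|)%N ->
  exists X, [/\ X \in F, X != A, X != B & dotv c (eS R A) <= dotv c (eS R X)].
Proof.
move=> fF exF AF BF iAB cmax ci0 gt2.
have [X [XF iX sX le2]] := exF A B i AF BF iAB.
have [[fA fB] fX] := (fF A AF, fF B BF, fF X XF).
exists X; split=> //.
- by apply: contraL iX => /eqP->; rewrite inE eqxx.
- by apply: contraL le2 => /eqP->; rewrite diffC -ltnNge.
rewrite -subr_ge0 dotvB_diff (big_setD1 i) //=.
have -> : eS R X 0 i - eS R A 0 i = 2 * eS R B 0 i.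
  have := eS_opp fX fA iX; have := eS_opp fA fB iAB; lra.
have nB : `|eS R B 0 i| = 1.
  by rewrite eS_full //; case: ifP => _; rewrite ?normrN normr1.
have ciE : c 0 i * eS R B 0 i = `|c 0 i|.
  by rewrite -(ger0_norm ci0) normrM nB mulr1.
have : `|\sum_(k in diff X A :\ i) c 0 k * (eS R X 0 k - eS R A 0 k)| <=
    2 * `|c 0 i|.
  apply: le_trans (ler_norm_sum _ _ _) _.
  apply: (@le_trans _ _ (\sum_(k in diff X A :\ i) 2 * `|c 0 i|)).
    apply: ler_sum => k; rewrite in_setD1 => /andP[_ kX].
    rewrite normrM mulrC; have /cmax le_c := subsetP sX k kX.
    apply: ler_pM => //.
    rewrite !eS_full // ler_norml; do 2 case: ifP => _; lra.
  rewrite sumr_const -[X in _ <= X]mulr1n ler_wpMn2l ?mulr_ge0 //.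
  by move: le2; rewrite (cardsD1 i) iX.
rewrite ler_norml => /andP[+ _].
by rewrite mulrCA ciE; lra.
Qed.

Lemma exchange_dm_dir F u v : (forall X, X \in F -> full X) -> F != set0 ->
  exchange F -> is_edge F u v -> dm_dir (u - v).
Proof.
move=> fF F0 exF /(edge_elim fF F0)[c [A [B [[AF BF neAB -> ->] [cB cX]]]]].
have [fA fB] := (fF A AF, fF B BF).
have [i0 i0AB] := diff_neq0 fA fB neAB.
have le2 : (#|diff A B| <= 2)%N.
  rewrite leqNgt; apply/negP => gt2.
  case: (arg_maxP (fun k => `|c 0 k|) i0AB) => i iAB imax.
  have third A' B' : A' \in F -> B' \in F -> i \in diff A' B' ->
      diff A' B' = diff A B -> 0 <= c 0 i * eS R B' 0 i ->
      exists X, [/\ X \in F, X != A', X != B' &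
        dotv c (eS R A') <= dotv c (eS R X)].
    move=> A'F B'F iA'B' eD c0.
    apply: (exchange_third fF exF A'F B'F iA'B') => //.
      by move=> j; rewrite eD => /imax.
    by rewrite eD.
  (* Swapping A and B reverses the sign of this product, so one of the two orientations applies. *)
  have [c0|c0] := leP 0 (c 0 i * eS R B 0 i).
    have [X [XF neA neB]] := third A B AF BF iAB erefl c0.
    by rewrite leNgt cX.
  have iBA : i \in diff B A by rewrite diffC.
  have [|X [XF neB neA]] := third B A BF AF iBA (diffC _ _).
    by rewrite (eS_opp fB fA iBA); lra.
  by rewrite cB leNgt cX.
have off k : k \notin diff A B -> (eS R A - eS R B) 0 k = 0.
  by rewrite in_diff negbK eSB => /eqP->; rewrite subrr.
pose l := (eS R A - eS R B) 0 i0.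
(* All nonzero coordinates are 2 or -2. The relative sign of the second one decides between
   [e_i + e_j] and [e_i - e_j]. *)
have on k : k \in diff A B -> (eS R A - eS R B) 0 k = l \/
    (eS R A - eS R B) 0 k = - l.
  move=> kAB; rewrite /l !eSB !(eS_opp fA fB) // !eS_full //.
  by do 2 case: ifP => _; first [left; lra | right; lra].
have wE : eS R A - eS R B =
    \sum_(k in diff A B) (eS R A - eS R B) 0 k *: ev R k.
  apply/rowP => k; rewrite summxE.
  have [kAB|/[dup] kAB /off->] := boolP (k \in diff A B).
    rewrite (big_setD1 k) //= [RHS]addrC big1 ?add0r => [|j].
      by rewrite [RHS]mxE [ev R k 0 k]mxE eqxx mulr1.
    by rewrite in_setD1 eq_sym mxE [ev R j 0 k]mxE => /andP[/negbTE->];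
      rewrite mulr0.
  rewrite big1 // => j jAB; rewrite mxE [ev R j 0 k]mxE.
  by case: eqP kAB => [->|]; rewrite ?jAB // mulr0.
have [E0|[j]] := set_0Vmem (diff A B :\ i0).
  left; exists i0, l; rewrite wE (big_setD1 i0) //= E0 big_set0 addr0.
  by [].
rewrite in_setD1 => /andP[ji jAB].
have Ej : diff A B :\ i0 = [set j].
  apply/esym/eqP; rewrite eqEcard sub1set in_setD1 ji jAB cards1.
  by move: le2; rewrite (cardsD1 i0) i0AB.
right; exists i0, j; split; first by rewrite eq_sym.
rewrite wE (big_setD1 i0) //= Ej big_set1 -/l.
case: (on j jAB) => ->; [left|right]; exists l.
  by rewrite scalerDr.
by rewrite scalerBr scaleNr.
Qed.
End Edges.

(** * Parity and even delta-matroids *)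

Definition parity n (B : {set elt n}) : bool :=
  odd #|[set k | (k, true) \in B]|.

Lemma odd_diff n (A B : {set elt n}) : full A -> full B ->
  odd #|diff A B| = parity A (+) parity B.
Proof.
move=> fA fB; rewrite /parity.
have cardE (p : pred 'I_n) : #|[set k | p k]| = (\sum_k p k)%N.
  by rewrite -sum1_card big_mkcond; apply: eq_bigr => k _; rewrite inE;
    case: (p k).
rewrite /diff !cardE -oddD -big_split /=.
rewrite !(big_morph odd oddD (erefl : odd 0 = false)).
apply: eq_bigr => k _; rewrite !sg_full //.
move/forallP: fA => /(_ k); move/forallP: fB => /(_ k).
by do 4 case: (_ \in _).
Qed.

(** One more element changes every [rk_val] by 1 or -1, so the maximum moves by at most 1. *)
Lemma rank_adj n (F : {set {set elt n}}) (g : {set elt n} -> int) S a :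
  (forall B, B \in F -> full B) -> is_rank_fun F g ->
  admissible S -> admissible (a |: S) -> a \notin S ->
  g (a |: S) <= g S + 1 /\ g S <= g (a |: S) + 1.
Proof.
move=> fF gF aS aaS aS'.
have [[B BF gS] leS] := gF S aS; have [[C CF gaS] leaS] := gF _ aaS.
have := leS C CF; have := leaS B BF; rewrite gS gaS.
rewrite !rk_setU1 ?fF //.
by do 2 case: ifP => _; lia.
Qed.

Lemma full_setU1 n (S : {set elt n}) i b : admissible S -> #|S| = n.-1 ->
  (i, false) \notin S -> (i, true) \notin S -> full ((i, b) |: S).
Proof.
move=> aS cS iF iT; apply/fullP; split; last first.
  rewrite cardsU1 cS; have -> : (i, b) \notin S by case: b.
  by rewrite add1n prednK // (leq_ltn_trans _ (ltn_ord i)).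
apply/forallP => k; move/forallP/(_ k): aS; rewrite !in_setU1 !xpair_eqE.
case: (eqVneq k i) => [->|//]; rewrite (negbTE iF) (negbTE iT) !orbF.
by case: b.
Qed.

(** Since p and q have opposite parity, the two values differ modulo 4. Both are within 1 of [x] and
    of the other parity, so they are [x + 1] and [x - 1]. *)
Lemma average_arith (n p q r : nat) (x : int) b : (0 < n)%N ->
  x = n.-1%:Z - 2 * r%:Z -> odd p = b -> odd q = ~~ b ->
  n%:Z - 2 * p%:Z <= x + 1 -> x <= n%:Z - 2 * p%:Z + 1 ->
  n%:Z - 2 * q%:Z <= x + 1 -> x <= n%:Z - 2 * q%:Z + 1 ->
  2 * x = n%:Z - 2 * p%:Z + (n%:Z - 2 * q%:Z).
Proof. case: b; lia. Qed.

Section Even.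
Variables (R : realFieldType) (n : nat).
Implicit Types (A B S T X : {set elt n}) (F : {set {set elt n}}).

Lemma even_dir_parity A B : full A -> full B -> A != B ->
  even_dir (eS R A - eS R B) -> parity A = parity B.
Proof.
move=> fA fB neAB [i [j [neij dir]]].
(* Both kinds of root are treated at once, with [m = l] or [m = - l]; [l] is nonzero because A and B
   differ. *)
have [l [m [l0 m0 wE]]] : exists l m, [/\ l != 0, m != 0 &
    forall k, eS R A 0 k - eS R B 0 k = l * (k == i)%:R + m * (k == j)%:R].
  have l0 l d : eS R A - eS R B = l *: d -> l != 0.
    apply: contra_eq_neq => ->; rewrite scale0r subr_eq0.
    by apply: contra neAB => /eqP/(eS_inj fA fB)->.
  case: dir => -[l e]; exists l; [exists l|exists (- l)];
    split; rewrite ?oppr_eq0 ?(l0 _ _ e) // => k; move/rowP/(_ k): e;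
    rewrite eSB => ->;
    by rewrite !(mxE, eqxx) ?mulrDr ?mulrN ?mulNr.
have Dij : diff A B = [set i; j].
  apply/setP => k; rewrite (in_diff R) -subr_eq0 wE !inE.
  have [->|neki] := eqVneq k i.
    by rewrite (negbTE neij) /= mulr1n mulr0n mulr0 addr0 mulr1 l0.
  case: (k == j); rewrite /= mulr0n mulr0 add0r ?mulr1n ?mulr0n.
    by rewrite mulr1 m0.
  by rewrite mulr0 eqxx.
have := odd_diff fA fB; rewrite Dij cards2 neij.
by case: (parity A); case: (parity B).
Qed.

Lemma even_average F g : is_delta_matroid R F -> is_rank_fun F g ->
  is_even_dm R F -> forall S i, admissible S -> #|S| = n.-1 ->
  (i, false) \notin S -> (i, true) \notin S ->
  2 * g S = g (S :|: [set (i, false)]) + g (S :|: [set (i, true)]).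
Proof.
move=> [F0 bF _] gF evF S i aS cS iF iT.
have fF B : B \in F -> full B by move=> /bF h; apply/fullP.
(* With the zero functional, two feasible sets of different parity would yield an edge joining
   different parities. *)
have par A B : A \in F -> B \in F -> parity A = parity B.
  move=> AF BF; apply/eqP/negP => /negP nepar.
  have c0 X : dotv (0 : 'rV[R]_n) (eS R X) = 0.
    by rewrite -(scale0r (0 : 'rV[R]_n)) dotvZl mul0r.
  have [|//|A' [B' [A'F B'F /eqP ne _ edge]]] :=
    @edge_sep R n F 0 _ (@parity n) A B fF AF BF _ _ nepar.
  - by move=> X _; rewrite !c0.
  - by rewrite !c0.
  apply: ne; apply: even_dir_parity (evF _ _ edge); rewrite ?fF //.
  by case: edge => /eqP ne _; apply/eqP => e; rewrite e in ne.
rewrite ![S :|: _]setUC.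
have fU b : full ((i, b) |: S) by apply: full_setU1.
have aU b : admissible ((i, b) |: S) by have [] := fullP _ (fU b).
have iS b : (i, b) \notin S by case: b.
have [f1 f2] := rank_adj fF gF aS (aU false) (iS false).
have [t1 t2] := rank_adj fF gF aS (aU true) (iS true).
have [[B BF gf] _] := gF _ (aU false); have [[C CF gt] _] := gF _ (aU true).
rewrite gf gt !rk_full ?fU ?fF // in f1 f2 t1 t2 *.
have := odd_diff (fU false) (fF B BF); have := odd_diff (fU true) (fF C CF).
have := odd_diff (fU false) (fU true); rewrite (par _ _ BF CF).
(* The two extensions of S differ at [i] alone, so their distances to B and C, which share a parity,
   have opposite parities. *)
have -> : diff ((i, false) |: S) ((i, true) |: S) = [set i].
  apply/setP => k; rewrite !inE /sg !in_setU1 !xpair_eqE.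
  case: (eqVneq k i) => [->|_]; last by rewrite /= eqxx.
  by rewrite /= ?eqxx (negbTE iF) (negbTE iT).
rewrite cards1; have [[D DF gD] _] := gF _ aS.
have := rk_card S (fF D DF); rewrite -gD cS.
have n0 : (0 < n)%N by apply: leq_ltn_trans (ltn_ord i).
by do 3 case: (parity _) => //=; move=> e _ oC oB;
  apply: (average_arith n0 e oB oC).
Qed.

Lemma average_even F g : is_delta_matroid R F -> is_rank_fun F g ->
  (forall S i, admissible S -> #|S| = n.-1 ->
    (i, false) \notin S -> (i, true) \notin S ->
    2 * g S = g (S :|: [set (i, false)]) + g (S :|: [set (i, true)])) ->
  is_even_dm R F.
Proof.
move=> [F0 bF dmF] gF avg u v edge.
have fF B : B \in F -> full B by move=> /bF h; apply/fullP.
case: (dmF _ _ edge) => // -[i [l wE]].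
have [c [A [B [[AF BF neAB uE vE] _]]]] := edge_elim fF F0 edge.
exfalso; rewrite {}uE {}vE {edge} in wE.
have [fA fB] := (fF A AF, fF B BF).
have off k : k != i -> sg A k = sg B k.
  move=> ki; apply: (@intr_inj R); apply/eqP; rewrite -!eSE -subr_eq0.
  move/rowP/(_ k): wE; rewrite eSB => ->.
  by rewrite !mxE (negbTE ki) mulr0.
have iAB : sg A i != sg B i.
  apply: contra neAB => /eqP e; apply/eqP/full_inj => // k.
  by have [->|/off] := eqVneq k i.
pose S := A :&: B.
(* B is A with the sign at [i] flipped, so the two extensions of S are A and B themselves. *)
have mem k b : (k, b) \in B = if k == i then (k, b) \notin A else (k, b) \in A.
  move/forallP: fA => /(_ k); move/forallP: fB => /(_ k).
  have [->|ne] := eqVneq k i.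
    by move: iAB; rewrite /sg; case: b; do 4 case: (_ \in _).
  by move: (off k ne); rewrite /sg; case: b; do 4 case: (_ \in _).
have iS b : (i, b) \notin S by rewrite inE mem eqxx andbN.
have [aA cA] := fullP _ fA.
have aS : admissible S := sub_adm (subsetIl _ _) aA.
have SU b : (i, b) |: S = if (i, b) \in A then A else B.
  apply/setP => -[k b']; rewrite in_setU1 xpair_eqE inE mem.
  have [->|ki] := eqVneq k i; last first.
    by rewrite andbb; case: ifP => _; rewrite ?mem ?(negbTE ki).
  rewrite andbN orbF /=; move/forallP: fA => /(_ i).
  by case: ifP; rewrite ?mem ?eqxx; case: b; case: b';
     do 2 case: (_ \in _).
have cS : #|S| = n.-1.
  have := cardsU1 (i, false) S; rewrite (iS false) SU add1n.
  have -> : #|if (i, false) \in A then A else B| = n.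
    by case: ifP => _; [exact: cA|exact: (bF B BF).2].
  by move/(congr1 predn)/esym.
have gmax U : U \in F -> n%:Z <= g U.
  move=> UF; have [aU cU] := bF U UF; have [_ /(_ U UF)] := gF U aU.
  by rewrite rk_full ?fF //; suff -> : diff U U = set0;
    [rewrite cards0; lia|apply/setP => k; rewrite !inE eqxx].
(* The right side is at least [2 * n], while [g S] is at most [n - 1]. *)
have := avg S i aS cS (iS false) (iS true).
rewrite ![S :|: _]setUC !SU.
have [[D DF gD] _] := gF S aS.
have := rk_card S (fF D DF); rewrite -gD cS.
have := gmax A AF; have := gmax B BF.
have n0 : (0 < n)%N by apply: leq_ltn_trans (ltn_ord i).
by do 2 case: ifP => _; lia.
Qed.

End Even.

Theorem theorem1p2 (R : realFieldType) (n : nat) :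
  (forall g : {set elt n} -> int,
     (exists F : {set {set elt n}}, is_delta_matroid R F /\ is_rank_fun F g)
     <->
     [/\ g set0 = 0,
         forall S, admissible S -> #|S| = 1%N -> `|g S| <= 1,
         forall S T, admissible S -> admissible T ->
           g S + g T >= g (S :&: T) + g (sqcup S T) &
         forall S, admissible S -> (g S = (#|S|)%:Z %[mod 2])%Z])
  /\
  (forall (F : {set {set elt n}}) (g : {set elt n} -> int),
     is_delta_matroid R F -> is_rank_fun F g ->
     (is_even_dm R F <->
      forall (S : {set elt n}) (i : 'I_n),
        admissible S -> #|S| = n.-1 ->
        (i, false) \notin S -> (i, true) \notin S ->
        2 * g S = g (S :|: [set (i, false)]) + g (S :|: [set (i, true)]))).
Proof.
split=> [g|F g dmF gF]; last first.
  by split; [apply: even_average|apply: average_even].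
split=> [[F [dmF gF]]|[g0 g1 g2 g3]].
  have [_ bF _] := dmF.
  (* Each [g S] is the value of one full set, so conditions (1), (2) and (4) follow from
     [rk_card]. *)
  have rk S : admissible S ->
      exists2 D : {set elt n}, full D & g S = rk_val S D.
    by move=> /gF[[D /bF/fullP fD gD] _]; exists D.
  split.
  - have [|D fD ->] := rk set0; first
      exact: sub_adm (sub0set _) (adm_sqcup set0 set0).
    by rewrite rk_card // set0D cards0.
  - move=> S aS cS; have [D fD ->] := rk S aS.
    have := subset_leq_card (subsetDl S D); rewrite rk_card // cS; lia.
  - by move=> S T; apply: dm_bisubmodular dmF gF.
  - by move=> S aS; have [D fD ->] := rk S aS; rewrite rk_card //; lia.
have F0 : feasible g != set0.
  have [|[D DF _] _] := feasible_rank g0 g1 g2 g3 (S := set0).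
    exact: sub_adm (sub0set _) (adm_sqcup set0 set0).
  by apply/set0Pn; exists D.
have fF X : X \in feasible g -> full X by case/feasibleP.
exists (feasible g); split; last exact: feasible_rank.
split=> // [B /fF/fullP //|u v].
exact: exchange_dm_dir fF F0 (feasible_exchange g0 g1 g2 g3).
Qed.
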